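(* For all integers $1 \le k \le n$, let $lt_{\alpha}$ denote the number of standard lexical tableaux of shape $\alpha$. Then \[ \sum_{\substack{ \alpha \vDash n,\\ \ell(\alpha)=k}} lt_{\alpha} = {n \brack k}, \] where ${n \brack k}$ is the unsigned Stirling number of the first kind, i.e. the number of permutations of $\{1,\dots,n\}$ having exactly $k$ disjoint cycles.
   Context: A composition $\alpha \vDash n$ is a finite tuple of positive integers $(\alpha_1,\dots,\alpha_{\ell(\alpha)})$ summing to $n$. Its diagram has left-justified rows, row $i$ (counted from the bottom) having $\alpha_i$ cells. For a word $w=w_1\cdots w_m$ over a totally ordered alphabet, its cyclic shifts are $w_{i+1}\cdots w_m w_1\cdots w_i$ for $i\in\{1,\dots,m\}$; $w$ is a necklace word if it is lexicographically smallest (weakly) among all its cyclic shifts. A lexical tableau of shape $\alpha$ and type (content) $\beta$ is a filling of the diagram of $\alpha$ with positive integers such that the integer $i$ appears exactly $\beta_i$ times, the entries of the first column strictly increase from row $1$ upward, and for each $i$ the word formed by the entries of row $i$ read left to right is a necklace word. A lexical tableau is standard if its type is $(1,1,\dots,1)=(1^n)$, i.e. it uses each of $1,\dots,n$ exactly once. *)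

(* Defs.v *)
From HB Require Import structures.
From mathcomp Require Import all_boot all_order all_fingroup.

Set Implicit Arguments.
Unset Strict Implicit.
Unset Printing Implicit Defensive.

Definition is_composition (n : nat) (alpha : seq nat) : bool :=
  all (ltn 0) alpha && (sumn alpha == n).

(* Rows and columns are numbered from 0; row 0 is the bottom row. *)
Definition diagram (alpha : seq nat) : finType :=
  {i : 'I_(size alpha) & 'I_(nth 0 alpha i)}.

Definition cell (alpha : seq nat) (i : 'I_(size alpha))
    (j : 'I_(nth 0 alpha i)) : diagram alpha :=
  Tagged (fun i : 'I_(size alpha) => 'I_(nth 0 alpha i)) j.

Definition cell_row (alpha : seq nat) (c : diagram alpha) : nat := tag c.

Definition cell_col (alpha : seq nat) (c : diagram alpha) : nat := tagged c.

Definition row_word (alpha : seq nat) (T : diagram alpha -> nat)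
    (i : 'I_(size alpha)) : seq nat :=
  [seq T (cell j) | j <- enum 'I_(nth 0 alpha i)].

(* [rot i w] is the cyclic shift w_{i+1} ... w_m w_1 ... w_i; [seqlexi] is
   [seq] with the lexicographic order. *)
Definition necklace (d : Order.disp_t) (A : orderType d) (w : seq A) : bool :=
  all (fun i => ((w : seqlexi A) <= (rot i w : seqlexi A))%O)
      (iota 1 (size w)).

(* beta_i is [nth 0 beta i.-1], hence 0 for i > size beta; [has_typeP] is the
   unbounded form of the definition. *)
Definition has_type (alpha beta : seq nat) (T : diagram alpha -> nat) : bool :=
  [forall c, 0 < T c <= size beta] &&
  [forall i : 'I_(size beta), #|[set c | T c == i.+1]| == nth 0 beta i].

Lemma has_typeP (alpha beta : seq nat) (T : diagram alpha -> nat) :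
  reflect ((forall c, 0 < T c) /\
           (forall i, 0 < i -> #|[set c | T c == i]| = nth 0 beta i.-1))
          (has_type beta T).
Proof.
apply: (iffP andP) => [[/forallP T_bd /forallP T_ct]|[T_gt0 T_ct]].
  split=> [c|[//|i] _ /=]; first by case/andP: (T_bd c).
  have [lt_i|le_i] := ltnP i (size beta); first exact/eqP/(T_ct (Ordinal lt_i)).
  rewrite nth_default //; apply/eqP; rewrite cards_eq0; apply/eqP/setP=> c.
  rewrite !inE; apply/eqP=> Tc; case/andP: (T_bd c) => _.
  by rewrite Tc ltnNge le_i.
split; apply/forallP; last by move=> i; rewrite T_ct.
move=> c; rewrite T_gt0 leqNgt; apply/negP=> lt_c.
have := T_ct (T c) (T_gt0 c); rewrite nth_default; last first.
  by move: lt_c; case: (T c).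
move/eqP; rewrite cards_eq0 => /eqP/setP/(_ c).
by rewrite !inE eqxx.
Qed.

Definition first_col_increasing (alpha : seq nat) (T : diagram alpha -> nat) :
    bool :=
  [forall c, forall c',
    [&& cell_col c == 0, cell_col c' == 0 & cell_row c < cell_row c']
      ==> (T c < T c')].

Definition lexical_tableau (alpha beta : seq nat) (T : diagram alpha -> nat) :
    bool :=
  [&& has_type beta T,
      first_col_increasing T &
      [forall i : 'I_(size alpha), necklace (row_word T i)]].

Definition standard_lexical_tableau (alpha : seq nat)
    (T : diagram alpha -> nat) : bool :=
  lexical_tableau (nseq (sumn alpha) 1) T.

(* Every standard lexical tableau has entries in {1, ..., n} with
   n = sumn alpha, so counting fillings with values in 'I_n.+1 loses none. *)
Definition num_standard_lt (alpha : seq nat) : nat :=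
  #|[set T : {ffun diagram alpha -> 'I_(sumn alpha).+1} |
      standard_lexical_tableau (fun c => T c : nat)]|.

(* [porbits s] is the set of cycles of s, fixed points included. *)
Definition stirling1 (n k : nat) : nat :=
  #|[set s : 'S_n | #|porbits s| == k]|.

(* Main.v *)
Require Import Defs.
From HB Require Import structures.
From mathcomp Require Import all_boot all_order all_fingroup.

Set Implicit Arguments.
Unset Strict Implicit.
Unset Printing Implicit Defensive.

(** A word without repetition is a necklace word exactly when its first letter
is its minimum.  The rows of a standard lexical tableau are therefore the
cycles of a permutation, each written from its minimum, and listed by
increasing minimum.  This presentation of a permutation is unique, so the
standard lexical tableaux of shape [alpha] are in bijection with the
permutations whose list of cycle lengths, taken in that order, is [alpha];
summing over [alpha] counts the permutations with [k] cycles. *)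

(** * Cycles of a permutation, represented by their minima *)

Section CycleMinima.

Variable n : nat.
Implicit Types (s : 'S_n) (x y : 'I_n).

Definition cycle_min s x : bool := [forall y in porbit s x, x <= y].

(** The filter keeps the order of [enum], so the minima come out increasing; this order numbers the
    cycles as rows. *)
Definition cycle_minima s : seq 'I_n := [seq x <- enum 'I_n | cycle_min s x].

Definition cycle_shape s : seq nat := [seq #|porbit s x| | x <- cycle_minima s].

Lemma mem_cycle_minima s x : (x \in cycle_minima s) = cycle_min s x.
Proof. by rewrite mem_filter mem_enum andbT. Qed.

Lemma cycle_minima_uniq s : uniq (cycle_minima s).
Proof. by rewrite filter_uniq ?enum_uniq. Qed.

Lemma sorted_enum_ord : sorted (fun x y => x < y) (enum 'I_n).
Proof.
by rewrite -(sorted_map (f := val) (e' := ltn)) val_enum_ord iota_ltn_sorted.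
Qed.

Lemma cycle_minima_sorted s : sorted (fun x y => x < y) (cycle_minima s).
Proof.
by apply: sorted_filter sorted_enum_ord => x y z; apply: ltn_trans.
Qed.

(** Two minima of the same cycle bound each other. *)
Lemma cycle_min_inj s : {in cycle_min s &, injective (porbit s)}.
Proof.
move=> x y /forall_inP minx /forall_inP miny Exy; apply/val_inj/eqP.
by rewrite eqn_leq minx ?miny // ?Exy ?porbit_id // -Exy porbit_id.
Qed.

Lemma cycle_min_exists s x : exists2 y, cycle_min s y & x \in porbit s y.
Proof.
case: (arg_minnP (fun y : 'I_n => y : nat) (porbit_id s x)) => y yx miny.
have /eqP Eyx: porbit s y == porbit s x by rewrite eq_porbit_mem.
exists y; last by rewrite porbit_sym.
by apply/forall_inP=> z; rewrite Eyx; apply: miny.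
Qed.

Lemma imset_cycle_min s : [set porbit s x | x in cycle_min s] = porbits s.
Proof.
apply/setP=> P; apply/imsetP/imsetP=> [[x _ ->]|[x _ ->]]; first by exists x.
have [y miny xy] := cycle_min_exists s x.
by exists y => //; apply/eqP; rewrite eq_porbit_mem.
Qed.

Lemma size_cycle_shape s : size (cycle_shape s) = #|porbits s|.
Proof.
rewrite size_map -imset_cycle_min card_in_imset; last exact: cycle_min_inj.
by rewrite cardE /cycle_minima enumT.
Qed.

Lemma sumn_cycle_shape s : sumn (cycle_shape s) = n.
Proof.
rewrite sumnE big_map big_filter big_enum_cond /=.
(* The sum over minima becomes a sum over cycles; the points of ['I_n] are then counted cycle by
   cycle. *)
rewrite -(big_imset (fun P : {set 'I_n} => #|P|) (@cycle_min_inj s)) /=.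
rewrite imset_cycle_min -[RHS]card_ord -sum1_card.
rewrite (partition_big (porbit s) (mem (porbits s))) /=; last first.
  by move=> x _; apply: imset_f.
apply: eq_bigr => P /imsetP[x _ ->]; rewrite -sum1_card.
by apply: eq_bigl => y; rewrite eq_porbit_mem.
Qed.

Lemma cycle_shape_composition s : is_composition n (cycle_shape s).
Proof.
rewrite /is_composition sumn_cycle_shape eqxx andbT all_map.
by apply/allP=> x _ /=; rewrite lt0n card_porbit_neq0.
Qed.

Lemma iter_porbit_inj s x i j :
  i < #|porbit s x| -> j < #|porbit s x| -> iter i s x = iter j s x -> i = j.
Proof.
move=> lti ltj; rewrite -(nth_traject s lti) -(nth_traject s ltj) => /eqP.
by rewrite nth_uniq ?size_traject ?uniq_traject_porbit // => /eqP.
Qed.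

End CycleMinima.

(** * Necklace words without repetition *)

Lemma necklace_uniqP (w : seq nat) :
  uniq w -> reflect {in w, forall y, head 0 w <= y} (necklace w).
Proof.
case: w => [|x w] Uw; first by constructor.
apply: (iffP allP) => [neck y yw|minx i].
  have [->|neq_xy] := eqVneq y x; first by [].
  (* The shift that begins with [y] is compared with the word through first letters. *)
  have := neck (index y (x :: w)).
  rewrite mem_iota add1n ltnS index_size andbT lt0n.
  have [|_ /(_ isT)] := eqVneq (index y (x :: w)) 0.
    by rewrite /= eq_sym (negPf neq_xy).
  by rewrite /rot (drop_nth 0) ?index_mem // nth_index //= lexi_cons => /andP[].
rewrite mem_iota add1n ltnS => /andP[i_gt0].
rewrite leq_eqVlt => /predU1P[->|lti].
  by rewrite rot_size.
(* Without repetition the two first letters differ, so they alone decide the comparison. *)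
have neq_x : x != nth 0 (x :: w) i.
  by rewrite -[X in X != _]/(nth 0 (x :: w) 0) nth_uniq // eq_sym -lt0n.
rewrite /rot (drop_nth 0) //= neqhead_lexiE // ltEnat /= ltn_neqAle neq_x.
by apply: minx; apply: mem_nth.
Qed.

(** * Cells of a diagram and conditions for a standard filling *)

Section Diagram.

Variable alpha : seq nat.
Implicit Types c : diagram alpha.

Lemma cell_row_lt c : cell_row c < size alpha.
Proof. exact: ltn_ord. Qed.

Lemma cell_col_lt c : cell_col c < nth 0 alpha (cell_row c).
Proof. exact: ltn_ord. Qed.

Lemma cell_eq c c' :
  cell_row c = cell_row c' -> cell_col c = cell_col c' -> c = c'.
Proof.
case: c c' => [i j] [i' j']; rewrite /cell_row /cell_col /= => /val_inj Ei.
by case: i' / Ei j' => j' /val_inj ->.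
Qed.

Lemma cell_exists i j : i < size alpha -> j < nth 0 alpha i ->
  exists2 c : diagram alpha, cell_row c = i & cell_col c = j.
Proof.
by move=> lti ltj; exists (@cell alpha (Ordinal lti) (Ordinal ltj)).
Qed.

Lemma map_nth_enum_ord :
  [seq nth 0 alpha (i : 'I_(size alpha)) | i <- enum 'I_(size alpha)] = alpha.
Proof.
by rewrite (map_comp (nth 0 alpha) val) val_enum_ord map_nth_iota0 ?take_size.
Qed.

Lemma card_diagram : #|diagram alpha| = sumn alpha.
Proof.
rewrite card_tagged -[in RHS]map_nth_enum_ord; congr sumn.
by apply: eq_map => i; apply: card_ord.
Qed.

(** There are [sumn alpha] cells and as many admissible values, so an injective filling takes each
    value exactly once. *)
Lemma has_standard_typeP (T : diagram alpha -> nat) :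
  reflect (injective T /\ forall c, 0 < T c <= sumn alpha)
          (has_type (nseq (sumn alpha) 1) T).
Proof.
apply: (iffP andP); rewrite size_nseq => -[].
  move=> /forallP T_bd /forallP T_ct; split=> // c c' ET.
  have /andP[T_gt0 leT] := T_bd c.
  have ltT : (T c).-1 < sumn alpha by rewrite prednK.
  have := T_ct (Ordinal ltT).
  rewrite /= nth_nseq ltT prednK // => /cards1P[d Ed].
  have /set1P -> : c \in [set d] by rewrite -Ed inE.
  by have /set1P -> : c' \in [set d] by rewrite -Ed inE ET.
move=> T_inj T_bd; split; apply/forallP=> //= i.
have ltT c : (T c).-1 < sumn alpha by case/andP: (T_bd c) => /prednK ->.
pose t c := Ordinal (ltT c).
have T_t c : T c = (t c).+1 by case/andP: (T_bd c) => /prednK.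
have t_inj : injective t by move=> c c' Et; apply: T_inj; rewrite !T_t Et.
have [|u uK tK] := inj_card_bij t_inj; first by rewrite card_ord card_diagram.
rewrite nth_nseq ltn_ord; apply/cards1P; exists (u i); apply/setP=> c.
by rewrite !inE T_t eqSS -(inj_eq t_inj) tK.
Qed.

(** Injectivity makes each row repetition-free, so the necklace condition says that its first cell
    holds the row minimum. *)
Lemma necklace_row_wordP (T : diagram alpha -> nat) :
  injective T -> all (ltn 0) alpha ->
  reflect (forall c c', cell_row c = cell_row c' -> cell_col c = 0 -> T c <= T c')
          [forall i : 'I_(size alpha), necklace (row_word T i)].
Proof.
move=> T_inj alpha_gt0.
have Urow i : uniq (row_word T i).
  rewrite map_inj_uniq ?enum_uniq // => j j' /T_inj Ej; apply: val_inj.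
  exact: (congr1 (@cell_col alpha) Ej).
have head_row (i : 'I_(size alpha)) (lti : 0 < nth 0 alpha i) :
    head 0 (row_word T i) = T (@cell alpha i (Ordinal lti)).
  rewrite -nth0 /row_word (nth_map (Ordinal lti)) ?size_enum_ord //.
  by congr (T (cell _)); apply: (nth_ord_enum _ (Ordinal lti)).
apply: (iffP forallP) => [neck [i j] [i' j'] | minT i].
  rewrite /cell_row /cell_col /= => /val_inj Ei.
  case: i' / Ei j' => j' j0; have lti : 0 < nth 0 alpha i by apply: leq_ltn_trans (ltn_ord j).
  have /(necklace_uniqP (Urow i))/(_ (T (cell j'))) := neck i.
  rewrite (head_row _ lti) map_f ?mem_enum // => /(_ isT).
  by congr (T _ <= _); apply: cell_eq.
apply/(necklace_uniqP (Urow i)) => _ /mapP[j _ ->].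
have lti : 0 < nth 0 alpha i by apply: (all_nthP 0 alpha_gt0).
by rewrite (head_row _ lti); apply: minT.
Qed.

Lemma standard_lexical_tableauP (T : diagram alpha -> nat) :
  all (ltn 0) alpha ->
  reflect [/\ injective T, forall c, 0 < T c <= sumn alpha,
              forall c c', cell_col c = 0 -> cell_col c' = 0 ->
                cell_row c < cell_row c' -> T c < T c'
            & forall c c', cell_row c = cell_row c' -> cell_col c = 0 ->
                T c <= T c']
          (standard_lexical_tableau T).
Proof.
move=> alpha_gt0; apply: (iffP and3P) => [[]|[T_inj T_bd T_col T_row]].
  move=> /has_standard_typeP[T_inj T_bd] /forallP T_col.
  move=> /(necklace_row_wordP T_inj alpha_gt0) T_row; split=> // c c' c0 c'0 ltc.
  by have /forallP/(_ c') := T_col c; rewrite c0 c'0 ltc.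
split; [exact/has_standard_typeP | | exact/necklace_row_wordP].
apply/'forall_forallP => c c'; apply/implyP=> /and3P[/eqP c0 /eqP c'0].
exact: T_col.
Qed.

(** * From permutations to tableaux *)

Hypothesis alpha_gt0 : all (ltn 0) alpha.
Local Notation n := (sumn alpha).
Variable x0 : 'I_n.

(** Each row runs through one cycle from its minimum. The default [x0] is not reached when
    [cycle_shape s = alpha]. *)
Definition cycle_entry (s : 'S_n) c : 'I_n :=
  iter (cell_col c) s (nth x0 (cycle_minima s) (cell_row c)).

(** [lift ord0] adds 1, since points of ['I_n] start at 0 and entries at 1. *)
Definition cycle_tableau (s : 'S_n) : {ffun diagram alpha -> 'I_n.+1} :=
  [ffun c => lift ord0 (cycle_entry s c)].

Lemma cycle_tableauE s c : cycle_tableau s c = (cycle_entry s c).+1 :> nat.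
Proof. by rewrite ffunE lift0. Qed.

Section Shape.

Variable s : 'S_n.
Hypothesis shape_s : cycle_shape s = alpha.

Lemma size_cycle_minima : size (cycle_minima s) = size alpha.
Proof. by rewrite -(congr1 size shape_s) size_map. Qed.

Lemma card_porbit_nth i : i < size alpha ->
  #|porbit s (nth x0 (cycle_minima s) i)| = nth 0 alpha i.
Proof.
move=> lti; rewrite -(congr1 (nth 0 ^~ i) shape_s).
by rewrite (nth_map x0) ?size_cycle_minima.
Qed.

Lemma nth_cycle_min i : i < size alpha -> cycle_min s (nth x0 (cycle_minima s) i).
Proof.
by move=> lti; rewrite -mem_cycle_minima mem_nth ?size_cycle_minima.
Qed.

Lemma porbit_cycle_entry c :
  porbit s (cycle_entry s c) = porbit s (nth x0 (cycle_minima s) (cell_row c)).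
Proof. by rewrite /cycle_entry -permX porbit_perm. Qed.

(** The cycle of an entry determines its row, and the column stays below the cycle length, where
    iterates are distinct. *)
Lemma cycle_entry_inj : injective (cycle_entry s).
Proof.
move=> c c' Ec; have lti := cell_row_lt c; have lti' := cell_row_lt c'.
have Ei : cell_row c = cell_row c'.
  have /cycle_min_inj : porbit s (nth x0 (cycle_minima s) (cell_row c)) =
      porbit s (nth x0 (cycle_minima s) (cell_row c')).
    by rewrite -!porbit_cycle_entry Ec.
  move=> /(_ (nth_cycle_min lti) (nth_cycle_min lti'))/eqP.
  by rewrite nth_uniq ?size_cycle_minima ?cycle_minima_uniq // => /eqP.
apply: cell_eq => //; move: Ec; rewrite /cycle_entry -Ei.
by apply: iter_porbit_inj; rewrite card_porbit_nth ?cell_col_lt // Ei cell_col_lt.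
Qed.

Lemma cycle_entry_surj x : exists c, cycle_entry s c = x.
Proof.
have [|u _ uK] := inj_card_bij cycle_entry_inj; last by exists (u x).
by rewrite card_ord card_diagram.
Qed.

Lemma cycle_tableau_standard :
  standard_lexical_tableau (fun c => cycle_tableau s c : nat).
Proof.
apply/standard_lexical_tableauP => //; split=> [c c'|c|c c'|c c'].
- by rewrite !cycle_tableauE => -[] /val_inj/cycle_entry_inj.
- by rewrite cycle_tableauE ltn_ord.
- rewrite !cycle_tableauE ltnS /cycle_entry => -> -> ltc /=.
  have tr : transitive (fun x y : 'I_n => x < y) by move=> ? ? ?; apply: ltn_trans.
  apply: (sorted_ltn_nth tr) => //; first exact: cycle_minima_sorted.
    by rewrite inE size_cycle_minima cell_row_lt.
  by rewrite inE size_cycle_minima cell_row_lt.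
rewrite !cycle_tableauE ltnS => Ec c0.
have /forall_inP := nth_cycle_min (cell_row_lt c).
rewrite {1}/cycle_entry c0; apply.
by rewrite Ec -porbit_cycle_entry porbit_id.
Qed.

End Shape.

(** The tableau determines [s]: an entry is sent to its right neighbour, and the last entry of a row
    to the first. *)
Lemma cycle_tableau_inj :
  {in [set s | cycle_shape s == alpha] &, injective cycle_tableau}.
Proof.
move=> s s'; rewrite !inE => /eqP shs /eqP shs' Ess'.
have E c : cycle_entry s c = cycle_entry s' c.
  by apply/val_inj/succn_inj; rewrite -!cycle_tableauE Ess'.
have Emin i : i < size alpha ->
    nth x0 (cycle_minima s) i = nth x0 (cycle_minima s') i.
  move=> lti; have [|c <- c0] := cell_exists lti (j := 0).
    by apply: (all_nthP 0 alpha_gt0).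
  by have := E c; rewrite /cycle_entry c0.
apply/permP=> x; have [c <-] := cycle_entry_surj shs x.
rewrite [in RHS]E /cycle_entry -!iterS.
(* At the end of a row, one more step closes the cycle and returns to its minimum. *)
have := cell_col_lt c; rewrite leq_eqVlt => /predU1P[Ec|ltc].
  have lti := cell_row_lt c.
  rewrite Ec -{1}(card_porbit_nth shs lti) -(card_porbit_nth shs' lti).
  by rewrite !iter_porbit Emin.
have [d rd cd] := cell_exists (cell_row_lt c) ltc.
by have := E d; rewrite /cycle_entry rd cd.
Qed.

(** * From tableaux back to permutations *)

Definition cyclic_next c : diagram alpha := cell (ordS (tagged c)).

Lemma cyclic_next_inj : injective cyclic_next.
Proof.
move=> c c' E; have Er : cell_row c = cell_row c'.
  exact: (congr1 (@cell_row alpha) E).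
move: E; case: c c' Er => [i j] [i' j']; rewrite /cell_row /= => /val_inj Ei.
case: i' / Ei j' => j' /(congr1 (@cell_col alpha)); rewrite /cell_col /= => Ej.
by congr Tagged; apply/ordS_inj/val_inj.
Qed.

Lemma iter_cyclic_next c k :
  cell_row (iter k cyclic_next c) = cell_row c /\
  cell_col (iter k cyclic_next c) = (cell_col c + k) %% nth 0 alpha (cell_row c).
Proof.
elim: k => [|k [IHr IHc]] /=; first by rewrite addn0 modn_small ?cell_col_lt.
rewrite -IHr; split=> //; rewrite {1}/cell_col /= -/(cell_col _) -/(cell_row _).
by rewrite IHc IHr -addn1 modnDml addn1 addnS.
Qed.

Lemma standard_cycle_tableau (T : {ffun diagram alpha -> 'I_n.+1}) :
  standard_lexical_tableau (fun c => T c : nat) ->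
  exists2 s, cycle_shape s = alpha & T = cycle_tableau s.
Proof.
move=> /(standard_lexical_tableauP _ alpha_gt0)[T_inj T_bd T_col T_row].
have ltT c : (T c).-1 < n by case/andP: (T_bd c) => /prednK ->.
pose t c := Ordinal (ltT c).
have T_t c : T c = (t c).+1 :> nat by case/andP: (T_bd c) => /prednK.
have t_inj : injective t by move=> c c' Et; apply: T_inj; rewrite !T_t Et.
have [|u tK uK] := inj_card_bij t_inj; first by rewrite card_ord card_diagram.
(* The permutation is [cyclic_next] transported along the bijection [t] from cells to points; its
   cycles are the rows. *)
have s_inj : injective (fun x => t (cyclic_next (u x))).
  by move=> x y /t_inj/cyclic_next_inj/(can_inj uK).
pose s := perm s_inj.
have iter_s k c : iter k s (t c) = t (iter k cyclic_next c).
  by elim: k => //= k ->; rewrite permE tK.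
have s_orbit c d : (t d \in porbit s (t c)) = (cell_row d == cell_row c).
  apply/porbitP/eqP=> [[k]|Er].
    by rewrite permX iter_s => /t_inj ->; case: (iter_cyclic_next c k).
  (* These steps lead from [c] past the end of its row to column 0, then on to the column of [d]. *)
  pose k := cell_col d + (nth 0 alpha (cell_row c) - cell_col c).
  exists k; rewrite permX iter_s; congr t.
  have [Er' Ec'] := iter_cyclic_next c k; apply: cell_eq; first by rewrite Er'.
  rewrite Ec' /k addnCA subnKC; last exact/ltnW/cell_col_lt.
  by rewrite modnDr modn_small // -Er cell_col_lt.
have first_gt0 i : 0 < nth 0 alpha (i : 'I_(size alpha)).
  by apply: (all_nthP 0 alpha_gt0).
pose first i := @cell alpha i (Ordinal (first_gt0 i)).
(* Both lists are strictly increasing, the second by the first-column condition, so equal membership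
   suffices. *)
have E_min : cycle_minima s = [seq t (first i) | i <- enum 'I_(size alpha)].
  apply: (@irr_sorted_eq _ (fun x y : 'I_n => x < y)).
  - by move=> ? ? ?; apply: ltn_trans.
  - by move=> x; apply: ltnn.
  - exact: cycle_minima_sorted.
  - apply: homo_sorted (@sorted_enum_ord _) => i j ltij.
    by rewrite -ltnS -!T_t T_col.
  move=> x; rewrite mem_cycle_minima; apply/forall_inP/mapP=> [|[i _ ->] y].
    (* A cycle minimum in cell [c] and the first entry of that row lie in one cycle and bound each
       other. *)
    rewrite -[x]uK; move: (u x) => c minc; exists (tag c); first by rewrite mem_enum.
    apply/val_inj/anti_leq; rewrite minc ?s_orbit //=.
    by rewrite -ltnS -!T_t T_row.
  by rewrite -[y]uK s_orbit => /eqP Er; rewrite -ltnS -!T_t T_row.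
have card_orbit i : #|porbit s (t (first i))| = nth 0 alpha i.
  have row_inj : injective (fun j => t (@cell alpha i j)).
    by move=> j j' /t_inj/(congr1 (@cell_col alpha))/val_inj.
  rewrite -[RHS]card_ord -(card_imset _ row_inj); apply: eq_card => x.
  apply/idP/imsetP=> [|[j _ ->]]; last by rewrite s_orbit.
  rewrite -[x]uK; move: (u x) => c; rewrite s_orbit => /eqP Er.
  have ltj : cell_col c < nth 0 alpha i by rewrite -[X in nth _ _ X]Er cell_col_lt.
  by exists (Ordinal ltj) => //; congr t; apply: cell_eq.
exists s.
  by rewrite /cycle_shape E_min -map_comp (eq_map card_orbit) map_nth_enum_ord.
apply/ffunP=> c; apply/val_inj; rewrite /= cycle_tableauE T_t; congr (nat_of_ord _).+1.
rewrite /cycle_entry E_min (nth_map (tag c)) ?size_enum_ord ?cell_row_lt //.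
rewrite (nth_ord_enum (tag c) (tag c)) iter_s; congr t.
have [Er Ec] := iter_cyclic_next (first (tag c)) (cell_col c).
by apply: cell_eq; rewrite ?Er ?Ec ?add0n ?modn_small ?cell_col_lt.
Qed.

(** * Counting by shape and summing over compositions *)

Lemma num_standard_lt_shape :
  num_standard_lt alpha = #|[set s : 'S_n | cycle_shape s == alpha]|.
Proof.
rewrite -(card_in_imset cycle_tableau_inj); apply: eq_card => T.
rewrite inE; apply/idP/imsetP=> [/standard_cycle_tableau[s shs ->]|[s]].
  by exists s; rewrite // inE shs.
by rewrite inE => /eqP shs ->; apply: cycle_tableau_standard.
Qed.

End Diagram.

(* A composition of n has all its parts at most n, so it is a tuple over
   'I_n.+1. *)
Theorem theorem3p3 (n k : nat) (hk : 1 <= k) (hkn : k <= n) :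
  \sum_(alpha : k.-tuple 'I_n.+1 | is_composition n (map (@nat_of_ord n.+1) alpha))
     num_standard_lt (map (@nat_of_ord n.+1) alpha) = stirling1 n k.
Proof.
(* This tuple is faithful for permutations with [k] cycles: [inord] loses nothing, as each cycle
   length is at most [n]. *)
pose sh (s : 'S_n) : k.-tuple 'I_n.+1 :=
  [tuple inord (nth 0 (cycle_shape s) i) | i < k].
have shE s : #|porbits s| = k -> map (@nat_of_ord n.+1) (sh s) = cycle_shape s.
  move=> sk; rewrite /= -map_comp -{2}(map_nth_enum_ord (cycle_shape s)).
  rewrite size_cycle_shape sk; apply: eq_map => i /=; rewrite inordK // ltnS.
  rewrite -{2}(sumn_cycle_shape s) sumnE (big_nth 0) big_mkord.
  have lti : i < size (cycle_shape s) by rewrite size_cycle_shape sk.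
  by rewrite (bigD1 (Ordinal lti)) //= leq_addr.
rewrite /stirling1 -sum1_card.
rewrite (partition_big sh (fun alpha : k.-tuple 'I_n.+1 =>
    is_composition n (map (@nat_of_ord n.+1) alpha))) /=; last first.
  by move=> s; rewrite inE => /eqP/shE ->; apply: cycle_shape_composition.
apply: eq_bigr => alpha /andP[alpha_gt0 /eqP sum_alpha].
have n_gt0 : 0 < n by apply: leq_trans hkn.
transitivity #|[set s : 'S_n | cycle_shape s == map (@nat_of_ord n.+1) alpha]|.
  (* The shape is generalized so that [n] can be replaced by its sum; positivity of [n] supplies the
     default point. *)
  move: (map _ alpha) alpha_gt0 sum_alpha => a a_gt0 Ea.
  case: n / Ea n_gt0 {sh shE hkn alpha} => a0.
  exact: num_standard_lt_shape (Ordinal a0).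
rewrite -sum1_card; apply: eq_bigl => s; rewrite !inE.
apply/eqP/andP=> [Es|[/eqP/shE <- /eqP -> //]].
(* The shape has [k] parts, which forces the number of cycles. *)
have sk : #|porbits s| = k by rewrite -size_cycle_shape Es size_map size_tuple.
split; first exact/eqP.
by apply/eqP/val_inj/(inj_map (@ord_inj n.+1)); rewrite -Es; apply: shE.
Qed.
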